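(* Let $G$ be a strongly paratopological gyrocommutative gyrogroup. Then $G$ is topologically isomorphic to a subgyrogroup of a topological product of first-countable $T_0$ strongly paratopological gyrocommutative gyrogroups if and only if $G$ is $T_0$ and $\omega$-balanced.
   Context: A gyrogroup is a nonempty set $G$ with a binary operation $\oplus$ such that: (G1) there is $0\in G$ with $0\oplus x=x=x\oplus 0$ for all $x\in G$; (G2) each $x\in G$ has an inverse $\ominus x\in G$ with $\ominus x\oplus x=0=x\oplus(\ominus x)$; (G3) for all $x,y\in G$ there is an automorphism $\mathrm{gyr}[x,y]$ of $(G,\oplus)$ with $x\oplus(y\oplus z)=(x\oplus y)\oplus \mathrm{gyr}[x,y](z)$ for all $z\in G$; (G4) $\mathrm{gyr}[x\oplus y,y]=\mathrm{gyr}[x,y]$ for all $x,y\in G$. It is gyrocommutative if $a\oplus b=\mathrm{gyr}[a,b](b\oplus a)$ for all $a,b\in G$. A subgyrogroup is a nonempty subset closed under $\oplus$ and $\ominus$. Products of gyrogroups carry the coordinatewise operation; a topological isomorphism is a bijective homomorphism (a map preserving $\oplus$) that is a homeomorphism; subgyrogroups carry the subspace topology. A paratopological gyrogroup is a gyrogroup with a topology for which $\oplus:G\times G\to G$ is (jointly) continuous. It is a strongly paratopological gyrogroup if there is a neighborhood base $\mathcal U$ at $0$ such that $\mathrm{gyr}[x,y](U)=U$ for all $U\in\mathcal U$ and $x,y\in G$. No separation axioms are assumed unless stated. A family $\gamma$ of open neighborhoods of $0$ is subordinated to a neighborhood $U$ of $0$ if (1) for all $x,y\in G$ there is $V\in\gamma$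 with $\ominus(x\oplus y)\oplus((V\oplus x)\oplus y)\subseteq U$, and (2) for all $x,y\in G$ there is $V\in\gamma$ with $V\subseteq\ominus(x\oplus y)\oplus((U\oplus x)\oplus y)$. A paratopological gyrogroup $G$ is $\omega$-balanced if for every neighborhood $U$ of $0$ there is a countable family of open neighborhoods of $0$ subordinated to $U$. (Operations on sets are elementwise.) *)

(* Defs.v *)
From HB Require Import structures.
From mathcomp Require Import all_boot.
From mathcomp Require Import all_classical.
From mathcomp Require Import topology.

Set Implicit Arguments.
Unset Strict Implicit.
Unset Printing Implicit Defensive.

Local Open Scope classical_set_scope.

Declare Scope gyro_scope.
Delimit Scope gyro_scope with gyro.
Local Open Scope gyro_scope.

(* The gyrations are part of the structure; they are determined by the
   operation, since left cancellation makes [gyr_assoc] fix [gyr x y z]. *)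
HB.mixin Record isGyrogroup G := {
  gadd : G -> G -> G;
  gzero : G;
  gopp : G -> G;
  gyr : G -> G -> G -> G;
  gadd0g : forall x, gadd gzero x = x;
  gaddg0 : forall x, gadd x gzero = x;
  gaddNg : forall x, gadd (gopp x) x = gzero;
  gaddgN : forall x, gadd x (gopp x) = gzero;
  gyr_bij : forall x y, bijective (gyr x y);
  gyr_morph : forall x y a b,
    gyr x y (gadd a b) = gadd (gyr x y a) (gyr x y b);
  gyr_assoc : forall x y z, gadd x (gadd y z) = gadd (gadd x y) (gyr x y z);
  gyr_loop : forall x y, gyr (gadd x y) y = gyr x y
}.

#[short(type="gyrogroupType")]
HB.structure Definition Gyrogroup := {G of isGyrogroup G}.

Arguments gzero {_}.

Notation "x ⊕ y" := (gadd x y) (at level 50, left associativity) : gyro_scope.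
Notation "⊖ x" := (gopp x) (at level 35, right associativity) : gyro_scope.

(* A gyrogroup with a topology; no compatibility between the two is assumed. *)
#[short(type="topologizedGyrogroupType")]
HB.structure Definition TopologizedGyrogroup :=
  {G of Topological G & isGyrogroup G}.

Definition gyrocommutative (G : gyrogroupType) :=
  forall a b : G, a ⊕ b = gyr a b (b ⊕ a).

Section Cancellation.
Variable G : gyrogroupType.
Implicit Types x y z : G.

Lemma gaddgI x : injective (gadd x).
Proof.
move=> y z /(congr1 (gadd (⊖ x))); rewrite !gyr_assoc gaddNg !gadd0g.
exact: (bij_inj (gyr_bij _ _)).
Qed.

Lemma gyr0g x y : gyr gzero x y = y.
Proof. by apply: (@gaddgI x); rewrite -{1}[x]gadd0g -gyr_assoc gadd0g. Qed.

Lemma gaddKg x y : ⊖ x ⊕ (x ⊕ y) = y.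
Proof. by rewrite gyr_assoc gaddNg gadd0g -gyr_loop gaddNg gyr0g. Qed.

Lemma goppK x : ⊖ (⊖ x) = x.
Proof. by apply: (@gaddgI (⊖ x)); rewrite gaddgN gaddNg. Qed.

Lemma gaddNKg x y : x ⊕ (⊖ x ⊕ y) = y.
Proof. by rewrite -{1}[x]goppK gaddKg. Qed.

Lemma gyrE x y z : gyr x y z = ⊖ (x ⊕ y) ⊕ (x ⊕ (y ⊕ z)).
Proof. by rewrite (gyr_assoc x y z) gaddKg. Qed.

Lemma gyr_invE x y z : gyr x y (⊖ y ⊕ (⊖ x ⊕ ((x ⊕ y) ⊕ z))) = z.
Proof. by rewrite gyrE !gaddNKg gaddKg. Qed.

End Cancellation.

Record subgyrogroup (G : gyrogroupType) := Subgyrogroup {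
  carrier : set G;
  carrier_neq0 : carrier !=set0;
  carrier_add : forall x y, carrier x -> carrier y -> carrier (x ⊕ y);
  carrier_opp : forall x, carrier x -> carrier (⊖ x)
}.

Definition subgyro (G : gyrogroupType) (S : subgyrogroup G) : Type :=
  set_type (carrier S).

Section SubgyroGyrogroup.
Variables (G : gyrogroupType) (S : subgyrogroup G).
Local Notation T := (subgyro S).
Implicit Types x y z : T.

Definition subgyro_val (x : T) : G := set_val x.

Lemma subgyro_val_inj : injective subgyro_val.
Proof. exact: val_inj. Qed.

Lemma subgyro_valP x : carrier S (subgyro_val x).
Proof. exact: set_mem (valP x). Qed.

Definition mk_subgyro (a : G) (Sa : carrier S a) : T := SigSub (mem_set Sa).

Lemma carrier0 : carrier S gzero.
Proof.
have [x Sx] := carrier_neq0 S; rewrite -(gaddNg x).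
by apply: carrier_add => //; exact: carrier_opp.
Qed.

Lemma carrier_gyr x y z :
  carrier S (gyr (subgyro_val x) (subgyro_val y) (subgyro_val z)).
Proof.
rewrite gyrE; have [Sx Sy Sz] := And3 (subgyro_valP x) (subgyro_valP y)
  (subgyro_valP z).
apply: carrier_add; first by apply: carrier_opp; exact: carrier_add.
by apply: carrier_add => //; exact: carrier_add.
Qed.

Let add x y := mk_subgyro (carrier_add (subgyro_valP x) (subgyro_valP y)).
Let opp x := mk_subgyro (carrier_opp (subgyro_valP x)).
Let zero := mk_subgyro carrier0.
Let sgyr x y z := mk_subgyro (carrier_gyr x y z).

Local Notation v := subgyro_val.

Let sgyr_bij x y : bijective (sgyr x y).
Proof.
exists (fun z => add (opp y) (add (opp x) (add (add x y) z))) => z;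
  apply: subgyro_val_inj.
- transitivity (⊖ v y ⊕ (⊖ v x ⊕ ((v x ⊕ v y) ⊕ gyr (v x) (v y) (v z)))).
    by [].
  by rewrite -gyr_assoc !gaddKg.
- transitivity (gyr (v x) (v y) (⊖ v y ⊕ (⊖ v x ⊕ ((v x ⊕ v y) ⊕ v z)))).
    by [].
  by rewrite gyr_invE.
Qed.

Let add0 x : add zero x = x.
Proof. by apply: subgyro_val_inj; exact: gadd0g. Qed.

Let addr0 x : add x zero = x.
Proof. by apply: subgyro_val_inj; exact: gaddg0. Qed.

Let addN x : add (opp x) x = zero.
Proof. by apply: subgyro_val_inj; exact: gaddNg. Qed.

Let addrN x : add x (opp x) = zero.
Proof. by apply: subgyro_val_inj; exact: gaddgN. Qed.

Let sgyr_morph x y (a b : T) : sgyr x y (add a b) = add (sgyr x y a) (sgyr x y b).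
Proof. by apply: subgyro_val_inj; exact: gyr_morph. Qed.

Let sgyr_assoc x y z : add x (add y z) = add (add x y) (sgyr x y z).
Proof. by apply: subgyro_val_inj; exact: gyr_assoc. Qed.

Let sgyr_loop x y : sgyr (add x y) y = sgyr x y.
Proof.
apply: funext => z; apply: subgyro_val_inj.
by rewrite /subgyro_val /= -[RHS](congr1 (@^~ (v z)) (gyr_loop (v x) (v y))).
Qed.

HB.instance Definition _ := @isGyrogroup.Build T add zero opp sgyr
  add0 addr0 addN addrN sgyr_bij sgyr_morph sgyr_assoc sgyr_loop.

End SubgyroGyrogroup.

HB.instance Definition _ (G : topologizedGyrogroupType) (S : subgyrogroup G) :=
  Topological.copy (subgyro S) (initial_topology (@subgyro_val G S)).

Section ProductGyrogroup.
Variables (I : Type) (H : I -> gyrogroupType).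
Local Notation T := (prod_topology (fun i => H i : Type)).

Let add (x y : T) : T := fun i => x i ⊕ y i.
Let opp (x : T) : T := fun i => ⊖ x i.
Let zero : T := fun=> gzero.
Let pgyr (x y z : T) : T := fun i => gyr (x i) (y i) (z i).

Let pgyr_bij x y : bijective (pgyr x y).
Proof.
exists (fun z => add (opp y) (add (opp x) (add (add x y) z))) => z;
  apply: functional_extensionality_dep => i; rewrite /add /opp /pgyr.
- by rewrite -gyr_assoc !gaddKg.
- by rewrite gyr_invE.
Qed.

HB.instance Definition _ := @isGyrogroup.Build T add zero opp pgyr
  (fun x => functional_extensionality_dep (fun i => gadd0g (x i)))
  (fun x => functional_extensionality_dep (fun i => gaddg0 (x i)))
  (fun x => functional_extensionality_dep (fun i => gaddNg (x i)))
  (fun x => functional_extensionality_dep (fun i => gaddgN (x i)))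
  pgyr_bij
  (fun x y a b => functional_extensionality_dep
     (fun i => gyr_morph (x i) (y i) (a i) (b i)))
  (fun x y z => functional_extensionality_dep
     (fun i => gyr_assoc (x i) (y i) (z i)))
  (fun x y => funext (fun z => functional_extensionality_dep
     (fun i => congr1 (fun f => f (z i)) (gyr_loop (x i) (y i))))).

End ProductGyrogroup.

HB.instance Definition _ (I : Type) (H : I -> topologizedGyrogroupType) :=
  Gyrogroup.copy (prod_topology (fun i => H i : Type))
    (prod_topology (fun i => (H i : gyrogroupType) : Type)).

Definition first_countable (T : topologicalType) := forall x : T,
  exists B : set (set T), [/\ countable B, B `<=` nbhs x &
    forall U, nbhs x U -> exists2 V, B V & V `<=` U].

Section ParatopologicalGyrogroups.
Variable G : topologizedGyrogroupType.

Definition paratopological := continuous (fun p : G * G => p.1 ⊕ p.2).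

Definition strongly_paratopological := paratopological /\
  exists B : set (set G), [/\ B `<=` nbhs gzero,
    forall N, nbhs gzero N -> exists2 U, B U & U `<=` N &
    forall U, B U -> forall x y, gyr x y @` U = U].

Definition subordinated (gamma : set (set G)) (U : set G) :=
  (forall x y, exists2 V, gamma V &
     [set ⊖ (x ⊕ y) ⊕ ((v ⊕ x) ⊕ y) | v in V] `<=` U) /\
  (forall x y, exists2 V, gamma V &
     V `<=` [set ⊖ (x ⊕ y) ⊕ ((u ⊕ x) ⊕ y) | u in U]).

Definition omega_balanced := forall U : set G, nbhs gzero U ->
  exists gamma : set (set G), [/\ countable gamma,
    gamma `<=` open_nbhs gzero & subordinated gamma U].

End ParatopologicalGyrogroups.

Definition topologically_isomorphic (G H : topologizedGyrogroupType) :=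
  exists (f : G -> H) (g : H -> G),
    [/\ forall x y, f (x ⊕ y) = f x ⊕ f y,
        cancel f g, cancel g f, continuous f & continuous g].

(* Main.v *)
(** If G is T0 and omega-balanced, every neighborhood of 0 contains a member of
    a countable family B of gyration-invariant neighborhoods of 0 that is closed
    under intersections, contains "halves", and absorbs the subordination
    conditions; hence the sets x ⊕ V, V in B, define a first-countable strongly
    paratopological topology on G. Its T0 quotient identifies x and y when
    ⊖ x ⊕ y and ⊖ y ⊕ x lie in every member of B; gyrocommutativity makes this
    relation compatible with ⊖, through x ⊖ y = gyr[x, ⊖ y](⊖ y ⊕ x). The
    diagonal map to the product of all these quotients is an embedding.

    Conversely, right translations of a gyrogroup are invertible by the left Bol
    identity, with inverses that are composites of translations. So in a
    paratopological gyrogroup the maps in the definition of subordination are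
    homeomorphisms fixing 0, and a countable base at 0 is subordinated to every
    neighborhood of 0. The sets that have a countable subordinated family form a
    filter, stable under preimages by continuous homomorphisms; convergence of
    this filter to 0 is then checked coordinatewise in the product. *)
From HB Require Import structures.
Require Import Defs.
From mathcomp Require Import all_boot.
From mathcomp Require Import all_classical.
From mathcomp Require Import topology.

Set Implicit Arguments.
Unset Strict Implicit.
Unset Printing Implicit Defensive.

Local Open Scope classical_set_scope.
Local Open Scope gyro_scope.

(** * Right translations in a gyrogroup *)

Section GyrogroupTheory.
Variable G : gyrogroupType.
Implicit Types x y z a b w : G.

(** Since b = ⊖ a ⊕ (a ⊕ b), the loop property turns gyr[b, a ⊕ b] into gyr[⊖ a, a ⊕ b], which
    undoes gyr[a, b] by left cancellation. *)
Lemma gyrK a b z : gyr b (a ⊕ b) (gyr a b z) = z.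
Proof.
have -> : gyr b (a ⊕ b) = gyr (⊖ a) (a ⊕ b).
  by rewrite -[RHS]gyr_loop gaddKg.
by rewrite gyrE gaddKg -gyr_assoc !gaddKg.
Qed.

(** Reassociating twice creates two gyrations, which cancel by [gyrK]. *)
Lemma left_bol b a z : b ⊕ (a ⊕ (b ⊕ z)) = (b ⊕ (a ⊕ b)) ⊕ z.
Proof. by rewrite (gyr_assoc a) gyr_assoc gyrK. Qed.

(* Right division: by the left Bol identity, the inverse of w |-> w ⊕ x. In
   contrast with a ⊖ gyr[a, x] x, it involves only translations of a, so it is
   continuous in a. *)
Definition rsub x a := ⊖ x ⊕ ((x ⊕ a) ⊕ ⊖ x).

Lemma gaddgK x w : rsub x (w ⊕ x) = w.
Proof. by rewrite /rsub -left_bol gaddgN gaddg0 gaddKg. Qed.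

Lemma rsubK x a : rsub x a ⊕ x = a.
Proof. by rewrite /rsub -left_bol gaddNg gaddg0 gaddKg. Qed.

(** The map in [subordinated]: the first condition there says that it sends V into U, the second
    that the image of U contains V. *)
Definition conj2 x y w := ⊖ (x ⊕ y) ⊕ ((w ⊕ x) ⊕ y).

Definition conj2_inv x y w := rsub x (rsub y ((x ⊕ y) ⊕ w)).

Lemma conj2K x y : cancel (conj2 x y) (conj2_inv x y).
Proof. by move=> w; rewrite /conj2 /conj2_inv gaddNKg !gaddgK. Qed.

Lemma conj2_invK x y : cancel (conj2_inv x y) (conj2 x y).
Proof. by move=> w; rewrite /conj2 /conj2_inv !rsubK gaddKg. Qed.

Lemma conj2_0 x y : conj2 x y gzero = gzero.
Proof. by rewrite /conj2 gadd0g gaddNg. Qed.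

Lemma conj2_inv0 x y : conj2_inv x y gzero = gzero.
Proof. by rewrite -[in LHS](conj2_0 x y) conj2K. Qed.

End GyrogroupTheory.

Lemma gadd_morph0 (G K : gyrogroupType) (h : G -> K) :
  (forall x y, h (x ⊕ y) = h x ⊕ h y) -> h gzero = gzero.
Proof. by move=> hD; apply: (@gaddgI _ (h gzero)); rewrite -hD !gaddg0. Qed.

Lemma gadd_morphN (G K : gyrogroupType) (h : G -> K) x :
  (forall x y, h (x ⊕ y) = h x ⊕ h y) -> h (⊖ x) = ⊖ h x.
Proof.
by move=> hD; apply: (@gaddgI _ (h x)); rewrite -hD !gaddgN (gadd_morph0 hD).
Qed.

(** * Topologies defined by a base of gyration-invariant sets *)

Section GyroBase.
Variable G : gyrogroupType.
Implicit Types (B : set (set G)) (V : set G) (x y : G).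

(** What makes the left translates x ⊕ V a base of a strongly paratopological topology. In [gb_conj]
    the increment stands to the right of x, unlike in [subordinated], to match these translates. *)
Record gyro_base B : Prop := GyroBase {
  gb_neq0 : B !=set0;
  gb_zero : forall V, B V -> V gzero;
  gb_cap : forall V W, B V -> B W -> exists2 X, B X & X `<=` V `&` W;
  gb_half : forall V, B V ->
    exists2 W, B W & forall a b, W a -> W b -> V (a ⊕ b);
  gb_gyr : forall V, B V -> forall x y, gyr x y @` V = V;
  gb_conj : forall V, B V -> forall x y, exists2 W, B W &
    forall w, W w -> V (⊖ (x ⊕ y) ⊕ ((x ⊕ w) ⊕ y)) }.

Definition base_nbhs B x : set_system G :=
  [set A | exists2 V, B V & forall v, V v -> A (x ⊕ v)].

(** The specialization preorder of the topology: y lies in every basic neighborhood x ⊕ V of x. *)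
Definition base_le B x y := forall V, B V -> V (⊖ x ⊕ y).

Variable B : set (set G).
Hypothesis hB : gyro_base B.

Lemma gb_in_gyr V x y z : B V -> V z -> V (gyr x y z).
Proof. by move=> BV Vz; rewrite -(gb_gyr hB BV x y); exists z. Qed.

(** Invariance of V makes z a gyration gyr[x, a] of some z' in V, so the reassociation only changes
    the point of V. *)
Lemma gb_assoc V x a z : B V -> V z ->
  exists2 z', V z' & (x ⊕ a) ⊕ z = x ⊕ (a ⊕ z').
Proof.
move=> BV; rewrite -{1}(gb_gyr hB BV x a) => -[z' Vz' <-].
by exists z' => //; rewrite gyr_assoc.
Qed.

(** Joint continuity of ⊕ at (x, y). By [gb_conj], (x ⊕ w) ⊕ y is (x ⊕ y) ⊕ u1 with u1 in a half U
    of V; reassociating, the sum becomes (x ⊕ y) ⊕ (u1 ⊕ u2) with u2 in U. *)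
Lemma gb_add V x y : B V -> exists2 W, B W &
  forall w u, W w -> W u -> V (⊖ (x ⊕ y) ⊕ ((x ⊕ w) ⊕ (y ⊕ u))).
Proof.
move=> BV; have [U BU UV] := gb_half hB BV.
have [W BW WU] := gb_conj hB BU x y.
have [X BX sX] := gb_cap hB BW BU.
exists X => // w u /sX[Ww _] /sX[_ Uu]; rewrite (gyr_assoc (x ⊕ w)).
have := WU _ Ww; set u1 := (X in U X) => Uu1.
have -> : (x ⊕ w) ⊕ y = (x ⊕ y) ⊕ u1 by rewrite gaddNKg.
have [u2 Uu2 ->] := gb_assoc (x ⊕ y) u1 BU (gb_in_gyr (x ⊕ w) y BU Uu).
by rewrite gaddKg; exact: UV.
Qed.

Lemma base_nbhs_filter x : ProperFilter (base_nbhs B x).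
Proof.
apply: Build_ProperFilter_ex => [A [V /(gb_zero hB) V0 VA]|].
  by exists (x ⊕ gzero); exact: VA.
split.
- by have [V BV] := gb_neq0 hB; exists V.
- move=> P Q [V BV VP] [W BW WQ]; have [X BX sX] := gb_cap hB BV BW.
  by exists X => // v /sX[/VP ? /WQ ?].
- by move=> P Q PQ [V BV VP]; exists V => // v /VP /PQ.
Qed.

Lemma base_nbhs_singleton x A : base_nbhs B x A -> A x.
Proof. by move=> [V /(gb_zero hB) V0 VA]; rewrite -(gaddg0 x); exact: VA. Qed.

Lemma base_nbhs_nbhs x A : base_nbhs B x A -> base_nbhs B x (base_nbhs B ^~ A).
Proof.
move=> [V BV VA]; have [W BW WV] := gb_half hB BV.
exists W => // w Ww; exists W => // z Wz.
have [z' Wz' ->] := gb_assoc x w BW Wz.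
by apply: VA; exact: WV.
Qed.

Lemma base_le_refl x : base_le B x x.
Proof. by move=> V BV; rewrite gaddNg; exact: gb_zero BV. Qed.

Lemma base_le_trans y x z : base_le B x y -> base_le B y z -> base_le B x z.
Proof.
move=> xy yz V BV; have [W BW WV] := gb_half hB BV.
have [w Ww e] := gb_assoc x (⊖ x ⊕ y) BW (yz W BW).
rewrite -(gaddNKg y z) -{1}(gaddNKg x y) e gaddKg.
by apply: WV => //; exact: xy.
Qed.

(** Apply [gb_add] to the increments ⊖ x ⊕ x' and ⊖ y ⊕ y'. *)
Lemma base_le_add x y x' y' : base_le B x x' -> base_le B y y' ->
  base_le B (x ⊕ y) (x' ⊕ y').
Proof.
move=> xx' yy' V BV; have [W BW WV] := gb_add x y BV.
by have := WV _ _ (xx' W BW) (yy' W BW); rewrite !gaddNKg.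
Qed.

(** Gyrocommutativity makes x ⊕ ⊖ y a gyration of ⊖ y ⊕ x, and V is gyration-invariant. *)
Lemma base_le_opp x y : gyrocommutative G ->
  base_le B y x -> base_le B (⊖ x) (⊖ y).
Proof.
by move=> Gc yx V BV; rewrite goppK Gc; apply: gb_in_gyr => //; exact: yx.
Qed.

End GyroBase.

(** * Countability, continuity and separation for the topology of a base *)

Section TopologyOfBase.
Variables (G : topologizedGyrogroupType) (B : set (set G)).
Hypotheses (hB : gyro_base B) (nbhsB : forall x : G, nbhs x = base_nbhs B x).

Lemma base_first_countable : countable B -> first_countable G.
Proof.
move=> cB x; exists ((fun V => [set x ⊕ v | v in V]) @` B); split.
- exact: (sub_countable (card_image_le _ _)).
- by move=> _ [V BV <-]; rewrite nbhsB; exists V => // v Vv; exists v.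
- move=> U; rewrite nbhsB => -[V BV VU]; exists [set x ⊕ v | v in V].
    by exists V.
  by move=> _ [v Vv <-]; exact: VU.
Qed.

Lemma base_nbhs0 V : B V -> nbhs gzero V.
Proof. by move=> BV; rewrite nbhsB; exists V => // v; rewrite gadd0g. Qed.

Lemma base_strongly_paratopological : strongly_paratopological G.
Proof.
split.
- move=> [x y] A /=; rewrite nbhsB => -[V BV VA].
  have [W BW WV] := gb_add hB x y BV.
  exists ([set x ⊕ w | w in W], [set y ⊕ w | w in W]) => /=.
    by rewrite !nbhsB; split; exists W => // w Ww; exists w.
  move=> [_ _] /= [[w Ww <-] [u Wu <-]]; rewrite /preimage/=.
  by rewrite -[X in A X](gaddNKg (x ⊕ y)); apply: VA; exact: WV.
- exists B; split; first exact: base_nbhs0.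
    by move=> N; rewrite nbhsB => -[V BV VN]; exists V => // v /VN;
    rewrite gadd0g.
  exact: gb_gyr.
Qed.

(** If ⊖ x ⊕ y misses V, then x ⊕ V is a neighborhood of x without y; for x <> y this happens in at
    least one direction. *)
Lemma base_kolmogorov : (forall x y, base_le B x y -> base_le B y x -> x = y) ->
  kolmogorov_space G.
Proof.
move=> sepB; suff sep x y : ~ base_le B x y -> exists A, nbhs x A /\ ~ A y.
  move=> x y /eqP xy; case: (pselect (base_le B x y)) => [lexy|].
    have /sep[A [Ax Ay]] : ~ base_le B y x by move/(sepB _ _ lexy).
    by exists A; right; rewrite !inE.
  by move=> /sep[A [Ax Ay]]; exists A; left; rewrite !inE.
move=> /existsNP[V /not_implyP[BV Vxy]]; exists [set x ⊕ v | v in V]; split.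
  by rewrite nbhsB; exists V => // v Vv; exists v.
by move=> [v Vv xv]; apply: Vxy; rewrite -xv gaddKg.
Qed.

End TopologyOfBase.

(** * The T0 quotient *)

Section BaseQuotient.
Local Open Scope quotient_scope.
Variables (G : topologizedGyrogroupType) (Gc : gyrocommutative G).
Variables (B : set (set G)) (hB : gyro_base B).

Definition base_eq : rel G := fun x y => `[< base_le B x y /\ base_le B y x >].

Lemma base_eq_refl : reflexive base_eq.
Proof. by move=> x; apply/asboolP; split; exact: base_le_refl. Qed.

Lemma base_eq_sym : symmetric base_eq.
Proof. by move=> x y; apply/asboolP/asboolP => -[]. Qed.

Lemma base_eq_trans : transitive base_eq.
Proof.
move=> y x z /asboolP[xy yx] /asboolP[yz zy]; apply/asboolP; split.
- exact: base_le_trans xy yz.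
- exact: base_le_trans zy yx.
Qed.

Canonical base_equiv := EquivRel base_eq base_eq_refl base_eq_sym base_eq_trans.

Definition base_quot : Type := {eq_quot base_equiv}.

HB.instance Definition _ := Quotient.on base_quot.
HB.instance Definition _ := Choice.on base_quot.

Local Notation Q := base_quot.
Definition quot_proj (x : G) : Q := \pi_Q x.

Lemma quot_proj_repr a : quot_proj (repr a) = a.
Proof. exact: reprK. Qed.

Lemma quot_proj_surj (a : Q) : exists x, a = quot_proj x.
Proof. by exists (repr a); rewrite quot_proj_repr. Qed.

Lemma quot_proj_eqP x y :
  quot_proj x = quot_proj y <-> base_le B x y /\ base_le B y x.
Proof. by split=> [/eqmodP/asboolP|?] //; apply/eqmodP/asboolP. Qed.

Definition quot_add (a b : Q) : Q := quot_proj (repr a ⊕ repr b).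
Definition quot_opp (a : Q) : Q := quot_proj (⊖ repr a).
(** The formula [gyrE] taken as a definition, so that compatibility with the projection follows from
    that of ⊕ and ⊖. *)
Definition quot_gyr (a b c : Q) : Q :=
  quot_add (quot_opp (quot_add a b)) (quot_add a (quot_add b c)).

Lemma quot_addE x y : quot_add (quot_proj x) (quot_proj y) = quot_proj (x ⊕ y).
Proof.
have [? ?] := (quot_proj_eqP _ _).1 (quot_proj_repr (quot_proj x)).
have [? ?] := (quot_proj_eqP _ _).1 (quot_proj_repr (quot_proj y)).
by apply/quot_proj_eqP; split; exact: base_le_add.
Qed.

Lemma quot_oppE x : quot_opp (quot_proj x) = quot_proj (⊖ x).
Proof.
have [? ?] := (quot_proj_eqP _ _).1 (quot_proj_repr (quot_proj x)).
by apply/quot_proj_eqP; split; exact: base_le_opp.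
Qed.

Lemma quot_gyrE x y z :
  quot_gyr (quot_proj x) (quot_proj y) (quot_proj z) = quot_proj (gyr x y z).
Proof. by rewrite /quot_gyr !(quot_addE, quot_oppE) gyrE. Qed.

Let qadd0 a : quot_add (quot_proj gzero) a = a.
Proof. by rewrite -(quot_proj_repr a) quot_addE gadd0g. Qed.

Let qaddr0 a : quot_add a (quot_proj gzero) = a.
Proof. by rewrite -(quot_proj_repr a) quot_addE gaddg0. Qed.

Let qaddN a : quot_add (quot_opp a) a = quot_proj gzero.
Proof. by rewrite -(quot_proj_repr a) quot_oppE quot_addE gaddNg. Qed.

Let qaddrN a : quot_add a (quot_opp a) = quot_proj gzero.
Proof. by rewrite -(quot_proj_repr a) quot_oppE quot_addE gaddgN. Qed.

Let qgyr_bij a b : bijective (quot_gyr a b).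
Proof.
exists (fun c => quot_add (quot_opp b)
    (quot_add (quot_opp a) (quot_add (quot_add a b) c))) => c;
  rewrite -(quot_proj_repr a) -(quot_proj_repr b) -(quot_proj_repr c).
- by rewrite quot_gyrE !(quot_addE, quot_oppE) -gyr_assoc !gaddKg.
- by rewrite !(quot_addE, quot_oppE) quot_gyrE gyr_invE.
Qed.

Let qgyr_morph a b c d :
  quot_gyr a b (quot_add c d) = quot_add (quot_gyr a b c) (quot_gyr a b d).
Proof.
rewrite -(quot_proj_repr a) -(quot_proj_repr b) -(quot_proj_repr c).
rewrite -(quot_proj_repr d).
by rewrite quot_addE !quot_gyrE quot_addE gyr_morph.
Qed.

Let qgyr_assoc a b c : quot_add a (quot_add b c) =
  quot_add (quot_add a b) (quot_gyr a b c).
Proof.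
by rewrite -(quot_proj_repr a) -(quot_proj_repr b) -(quot_proj_repr c)
  quot_gyrE !quot_addE gyr_assoc.
Qed.

Let qgyr_loop a b : quot_gyr (quot_add a b) b = quot_gyr a b.
Proof.
apply: funext => c.
rewrite -(quot_proj_repr a) -(quot_proj_repr b) -(quot_proj_repr c).
by rewrite quot_addE !quot_gyrE gyr_loop.
Qed.

HB.instance Definition _ := @isGyrogroup.Build Q 
  quot_add (quot_proj gzero) quot_opp quot_gyr
  qadd0 qaddr0 qaddN qaddrN qgyr_bij qgyr_morph qgyr_assoc qgyr_loop.

Lemma quot_projD x y : quot_proj (x ⊕ y) = quot_proj x ⊕ quot_proj y.
Proof. by rewrite -quot_addE. Qed.

Lemma quot_projN x : quot_proj (⊖ x) = ⊖ quot_proj x.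
Proof. by rewrite -quot_oppE. Qed.

Lemma quot_proj_gyr x y z :
  quot_proj (gyr x y z) = gyr (quot_proj x) (quot_proj y) (quot_proj z).
Proof. by rewrite -quot_gyrE. Qed.

Lemma quot_gyrocommutative : gyrocommutative Q.
Proof.
move=> a b; have [x ->] := quot_proj_surj a; have [y ->] := quot_proj_surj b.
by rewrite -!quot_projD -quot_proj_gyr -Gc.
Qed.

Definition quot_base : set (set Q) := (fun V => quot_proj @` V) @` B.

(** A point x equivalent to w in W is w ⊕ (⊖ w ⊕ x), a sum of two elements of W; hence a half of V
    has its saturation inside V. *)
Lemma quot_base_sat V : B V -> exists2 W, B W &
  quot_proj @^-1` (quot_proj @` W) `<=` V.
Proof.
move=> BV; have [W BW WV] := gb_half hB BV.
exists W => // x [w Ww /quot_proj_eqP[wx _]].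
by rewrite -(gaddNKg w x); apply: WV => //; exact: wx.
Qed.

Lemma quot_base_le x y :
  base_le quot_base (quot_proj x) (quot_proj y) -> base_le B x y.
Proof.
move=> xy V BV; have [W BW WV] := quot_base_sat BV; apply: WV.
rewrite /preimage/= quot_projD quot_projN.
by apply: (xy (quot_proj @` W)); exists W.
Qed.

Lemma quot_gyro_base : gyro_base quot_base.
Proof.
split.
- by have [V BV] := gb_neq0 hB; exists (quot_proj @` V), V.
- by move=> _ [V BV <-]; exists gzero => //; exact: gb_zero BV.
- move=> _ _ [V BV <-] [W BW <-]; have [X BX sX] := gb_cap hB BV BW.
  exists (quot_proj @` X); first by exists X.
  by move=> _ [x /sX[Vx Wx] <-]; split; exists x.
- move=> _ [V BV <-]; have [W BW WV] := gb_half hB BV.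
  exists (quot_proj @` W); first by exists W.
  move=> _ _ [a Wa <-] [b Wb <-]; rewrite -quot_projD.
  by exists (a ⊕ b) => //; exact: WV.
- move=> _ [V BV <-] a b.
  have [x ->] := quot_proj_surj a; have [y ->] := quot_proj_surj b.
  rewrite -{2}(gb_gyr hB BV x y) !image_comp.
  by apply: eq_imagel => z _; rewrite /= quot_proj_gyr.
- move=> _ [V BV <-] a b.
  have [x ->] := quot_proj_surj a; have [y ->] := quot_proj_surj b.
  have [W BW WV] := gb_conj hB BV x y; exists (quot_proj @` W).
    by exists W.
  move=> _ [w Ww <-]; exists (⊖ (x ⊕ y) ⊕ ((x ⊕ w) ⊕ y)); first exact: WV.
  by rewrite !(quot_projD, quot_projN).
Qed.

(** The topology is generated by the images of the members of B; it is not the quotient of the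
    topology of G. *)
HB.instance Definition _ := hasNbhs.Build Q (base_nbhs quot_base).
HB.instance Definition _ := Nbhs_isNbhsTopological.Build Q
  (base_nbhs_filter quot_gyro_base)
  (base_nbhs_singleton quot_gyro_base) (base_nbhs_nbhs quot_gyro_base).

Definition base_quotient : topologizedGyrogroupType := Q.

Lemma base_quotient_spec : countable B ->
  [/\ first_countable base_quotient, kolmogorov_space base_quotient,
      strongly_paratopological base_quotient & gyrocommutative base_quotient].
Proof.
move=> cB; split.
- apply: (base_first_countable (B := quot_base)) => //.
  exact: (sub_countable (card_image_le _ _)).
- apply: (base_kolmogorov (B := quot_base)) => // a b.
  have [x ->] := quot_proj_surj a; have [y ->] := quot_proj_surj b.
  by move=> /quot_base_le xy /quot_base_le yx; apply/quot_proj_eqP.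
- exact: (base_strongly_paratopological quot_gyro_base).
- exact: quot_gyrocommutative.
Qed.

End BaseQuotient.

(** * Countable bases from omega-balancedness *)

(** The closure of N under [Gam] and binary intersections, built in countably many countable stages.
    The last clause is its induction principle. *)
Lemma countable_closure (T : Type) (Gam : set T -> set (set T)) (N : set T) :
  (forall V, countable (Gam V)) ->
  exists B : set (set T), [/\ countable B, B N,
    forall V W, B V -> B W -> B (V `&` W),
    forall V, B V -> Gam V `<=` B &
    forall P : set (set T), P N -> (forall V W, P V -> P W -> P (V `&` W)) ->
      (forall V, P V -> Gam V `<=` P) -> B `<=` P].
Proof.
move=> cGam.
pose step (L : set (set T)) := L `|` (\bigcup_(V in L) Gam V)
  `|` [set V.1 `&` V.2 | V in L `*` L].
pose L n := iter n step [set N].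
have cL n : countable (L n).
  elim: n => [|n IH] //=; rewrite /step -bigcup2E.
  apply: bigcup_countable => //.
  move=> [|[|i]] _ //=; last first.
    exact: (sub_countable (card_image_le _ _)) (countableX _ _).
  rewrite -bigcup2E; apply: bigcup_countable => // -[|[|i]] _ //=.
  exact: bigcup_countable.
have LS n : L n `<=` L n.+1 by move=> V LV; left; left.
have Lle m n : m <= n -> L m `<=` L n.
  by move=> /subnK <-; elim: (n - m) => [|k IH] // V /IH; exact: LS.
exists (\bigcup_n L n); split.
- exact: bigcup_countable.
- by exists 0.
- move=> V W [m _ mV] [n _ nW]; exists (maxn m n).+1 => //; right.
  exists (V, W) => //; split => /=.
    by apply: Lle mV; exact: leq_maxl.
  by apply: Lle nW; exact: leq_maxr.
- by move=> V [n _ nV] W VW; exists n.+1 => //; left; right; exists V.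
- move=> P PN PI PG V [n _]; elim: n V => [|n IH] V /=; first by move=> ->.
  case=> [[/IH //|[W /IH PW VW]]|[[X Y] /= [/IH PX /IH PY] <-]].
    exact: PG VW.
  exact: PI.
Qed.

Section BaseExistence.
Variable G : topologizedGyrogroupType.
Hypotheses (Gstrong : strongly_paratopological G) (Gbal : omega_balanced G).

Definition inv_nbhs : set (set G) := [set V | nbhs gzero V /\
  forall x y, gyr x y @` V = V].

Lemma inv_nbhsP N : nbhs gzero N -> exists2 V, inv_nbhs V & V `<=` N.
Proof.
move=> N0; have [_ [B [Bn Bb Bg]]] := Gstrong.
by have [V BV VN] := Bb _ N0; exists V => //; split; [exact: Bn|exact: Bg].
Qed.

(** Gyrations are injective, so their images commute with intersections. *)
Lemma inv_nbhsI V W : inv_nbhs V -> inv_nbhs W -> inv_nbhs (V `&` W).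
Proof.
move=> [V0 gV] [W0 gW]; split=> [|x y]; first exact: filterI.
rewrite -{2}(gV x y) -{2}(gW x y) eqEsubset; split.
  by move=> _ [z [Vz Wz] <-]; split; exists z.
move=> _ [[z Vz <-] [z' Wz' /(bij_inj (gyr_bij x y)) e]].
by exists z => //; rewrite -e in Vz *.
Qed.

Lemma paratop_half V : nbhs gzero V ->
  exists2 W, nbhs gzero W & forall a b : G, W a -> W b -> V (a ⊕ b).
Proof.
have [cont _] := Gstrong.
rewrite -{1}[gzero]gadd0g => /(cont (gzero, gzero))[[P R] /= [P0 R0] PR].
exists (P `&` R); first exact: filterI.
by move=> a b [Pa _] [_ Rb]; exact: (PR (a, b)).
Qed.

(** What the next stage must supply for V: a half, stability under [conj2], and some W with x ⊕ W
    inside V ⊕ x. The last two combine into [gb_conj]. *)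
Definition refined_by (V : set G) (gamma : set (set G)) :=
  (exists2 W, gamma W & forall a b, W a -> W b -> V (a ⊕ b)) /\
  (forall x y, exists2 W, gamma W & forall w, W w -> V (conj2 x y w)) /\
  (forall x, exists2 W, gamma W &
     forall w, W w -> exists2 v, V v & x ⊕ w = v ⊕ x).

Lemma refined_by_exists V : inv_nbhs V -> exists gamma : set (set G),
  [/\ countable gamma, gamma `<=` inv_nbhs & refined_by V gamma].
Proof.
move=> [V0 gV]; have [W W0 WV] := paratop_half V0.
have [gam [cgam gamo [gam1 gam2]]] := Gbal V0.
(* Shrinks each neighborhood of 0 to an invariant one; elsewhere the value is arbitrary. *)
have [r rP] : {r & forall N, nbhs gzero N -> inv_nbhs (r N) /\ r N `<=` N}.
  apply: (@choice _ _ (fun N M => nbhs gzero N -> inv_nbhs M /\ M `<=` N)) => N.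
  case: (pselect (nbhs gzero N)) => [/inv_nbhsP[M]|]; last by exists setT.
  by exists M.
have rgam N : gam N -> inv_nbhs (r N) /\ r N `<=` N.
  by move=> /gamo/open_nbhs_nbhs/rP.
exists (r @` gam `|` [set r W]); split.
- rewrite -bigcup2E; apply: bigcup_countable => // -[|[|i]] _ //=.
  exact: (sub_countable (card_image_le _ _)).
- by move=> _ [[N /rgam[? _] <-]|->] //; have [] := rP _ W0.
- split; [|split].
  + exists (r W); first by right.
    have [_ rW] := rP _ W0.
    by move=> a b /rW Wa /rW Wb; exact: WV.
  + move=> x y; have [N gN NV] := gam1 x y.
    exists (r N); first by left; exists N.
    have [_ rN] := rgam _ gN.
    by move=> w /rN Nw; apply: NV; exists w.
  (* With y = 0 the second subordination condition reads: x ⊕ N is contained in V ⊕ x. *)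
  + move=> x; have [N gN NV] := gam2 x gzero.
    exists (r N); first by left; exists N.
    have [_ rN] := rgam _ gN.
    move=> w /rN/NV[v Vv <-]; exists v => //.
    by rewrite !gaddg0 gaddNKg.
Qed.

Lemma gyro_base_exists U : nbhs gzero U -> exists B : set (set G),
  [/\ gyro_base B, countable B, B `<=` nbhs gzero & exists2 V, B V & V `<=` U].
Proof.
move=> U0; have [N NI NU] := inv_nbhsP U0.
have [Gam GamP] : {Gam & forall V : set G, countable (Gam V) /\
    (inv_nbhs V -> Gam V `<=` inv_nbhs /\ refined_by V (Gam V))}.
  apply: (@choice _ _ (fun V g => countable g /\
    (inv_nbhs V -> g `<=` inv_nbhs /\ refined_by V g))) => V.
  case: (pselect (inv_nbhs V)) => [/refined_by_exists[g [? ? ?]]|nV].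
    by exists g.
  by exists set0.
have [B [cB BN BI BG Bmin]] := countable_closure N (fun V => (GamP V).1).
(* Induction over the closure: invariance survives intersections and refinement. *)
have Binv : B `<=` inv_nbhs.
  apply: Bmin => // [|V IV]; first exact: inv_nbhsI.
  by have [_ /(_ IV)[]] := GamP V.
have Bref V : B V -> refined_by V (Gam V).
  by move=> /Binv IV; have [_ /(_ IV)[]] := GamP V.
exists B; split=> //.
- split.
  + by exists N.
  + by move=> V /Binv[/nbhs_singleton].
  + by move=> V W BV BW; exists (V `&` W) => //; exact: BI.
  + move=> V BV; have [[W GW WV] _] := Bref _ BV.
    by exists W => //; exact: BG GW.
  + by move=> V /Binv[].
  + move=> V BV x y; have [_ [/(_ x y)[W GW WV] _]] := Bref _ BV.
    have BW := BG _ BV _ GW.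
    (* Refining W once more moves the increment from the right of x to its left, where [conj2]
       applies. *)
    have [_ [_ /(_ x)[X GX XW]]] := Bref _ BW.
    exists X; first exact: BG GX.
    by move=> w /XW[v Wv ->]; exact: WV.
- by move=> V /Binv[].
- by exists N.
Qed.

End BaseExistence.

(** * The diagonal embedding *)

Lemma nbhs_initialP (S : choiceType) (T : topologicalType) (f : S -> T)
    (x : initial_topology f) A :
  nbhs x A <-> exists2 U, nbhs (f x) U & f @^-1` U `<=` A.
Proof.
split=> [|[U Ux UA]].
  rewrite (@nbhsE (initial_topology f)) => -[_ [[U oU <-] Ux] UA].
  exists U => //.
  by apply: open_nbhs_nbhs; split.
by apply: filterS UA _; exact: (@initial_continuous S T f x U Ux).
Qed.

Section ProductTopology.
Variables (I : Type) (T : I -> topologicalType).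

(** The product topology is the supremum of the initial topologies of the projections. An arbitrary
    filter is allowed, since images of [omega_sets] will be used. *)
Lemma prod_topology_cvgP (F : set_system (prod_topology T))
    (t : prod_topology T) : Filter F ->
  F --> t <-> forall i A, nbhs (t i) A -> F [set x | A (x i)].
Proof.
move=> FF; split.
  move=> /cvg_sup Ft i A Ati; apply: (Ft i).
  by apply/nbhs_initialP; exists A.
move=> Ft; apply/cvg_sup => i A /nbhs_initialP[U /Ft FU UA].
exact: filterS UA FU.
Qed.

Lemma prod_topology_proj (i : I) (t : prod_topology T) A :
  nbhs (t i) A -> nbhs t [set x | A (x i)].
Proof. by have /prod_topology_cvgP := @cvg_id _ (nbhs t); apply. Qed.

End ProductTopology.

Lemma continuous_ladd (G : topologizedGyrogroupType) :
  paratopological G -> forall x : G, continuous (gadd x).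
Proof.
move=> cont x y A /(cont (x, y))[[P R] /= [Px Ry] PR].
apply: filterS Ry => z Rz; exact: (PR (x, z) (conj (nbhs_singleton Px) Rz)).
Qed.

Lemma continuous_radd (G : topologizedGyrogroupType) :
  paratopological G -> forall x : G, continuous (fun y => y ⊕ x).
Proof.
move=> cont x y A /(cont (y, x))[[P R] /= [Py Rx] PR].
apply: filterS Py => z Pz; exact: (PR (z, x) (conj Pz (nbhs_singleton Rx))).
Qed.

Arguments continuous_ladd {G} _ x.
Arguments continuous_radd {G} _ x.

Section Embedding.
Variables (G : topologizedGyrogroupType) (Gpara : paratopological G).

(** By continuity of the translation by ⊖ x, the set x ⊕ V is a neighborhood of x for every V in
    B. *)
Lemma quot_proj_continuous (Gc : gyrocommutative G) (B : set (set G))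
    (hB : gyro_base B) : B `<=` nbhs gzero ->
  continuous (quot_proj hB : G -> base_quotient Gc hB).
Proof.
move=> Bn x A [_ [V BV <-] VA].
have := continuous_ladd Gpara (⊖ x) x.
rewrite /continuous_at gaddNg => /(_ _ (Bn _ BV)).
apply: (@filterS _ (nbhs x)) => y Vy.
rewrite /preimage/= -(gaddNKg x y) (quot_projD Gc hB).
by apply: VA; exists (⊖ x ⊕ y).
Qed.

Variables (I : Type) (H : I -> topologizedGyrogroupType).
Variable f : forall i, G -> H i.
Hypothesis fD : forall i x y, f i (x ⊕ y) = f i x ⊕ f i y.
Hypothesis fc : forall i, continuous (f i).
Hypothesis f_sep : forall U : set G, nbhs gzero U ->
  exists i, exists2 V, nbhs gzero V & f i @^-1` V `<=` U.
Hypothesis Hpara : forall i, paratopological (H i).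
Hypothesis GT0 : kolmogorov_space G.

Definition diag (x : G) : prod_topology (fun i => H i : Type) := fun i => f i x.

Lemma diagD x y : diag (x ⊕ y) = diag x ⊕ diag y.
Proof. by apply: functional_extensionality_dep => i; exact: fD. Qed.

(** Translations carry [f_sep] from 0 to x: a single coordinate already detects each
    neighborhood. *)
Lemma f_nbhs x A : nbhs x A ->
  exists i, exists2 V, nbhs (f i x) V & f i @^-1` V `<=` A.
Proof.
have := continuous_ladd Gpara x gzero.
rewrite /continuous_at gaddg0 => cx /cx/f_sep[i [V V0 VA]].
exists i, [set z | V (⊖ f i x ⊕ z)].
  by apply: (continuous_ladd (@Hpara i) (⊖ f i x)); rewrite gaddNg.
move=> y Vy; rewrite -(gaddNKg x y); apply: VA.
by rewrite /preimage/= fD (gadd_morphN _ (@fD i)).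
Qed.

Lemma diag_inj : injective diag.
Proof.
move=> x y xy; apply: contrapT => /eqP/GT0[A [|] []]; rewrite !inE.
  move=> /f_nbhs[i [V Vx VA]]; apply; apply: VA.
  rewrite /preimage/= -[f i y]/(diag y i) -xy; exact: nbhs_singleton Vx.
move=> /f_nbhs[i [V Vx VA]]; apply; apply: VA.
rewrite /preimage/= -[f i x]/(diag x i) xy; exact: nbhs_singleton Vx.
Qed.

Lemma diag_carrier_neq0 : range diag !=set0.
Proof. by exists (diag gzero), gzero. Qed.

Lemma diag_carrier_add a b : range diag a -> range diag b -> range diag (a ⊕ b).
Proof. by move=> [x _ <-] [y _ <-]; exists (x ⊕ y) => //; rewrite diagD. Qed.

Lemma diag_carrier_opp a : range diag a -> range diag (⊖ a).
Proof.
by move=> [x _ <-]; exists (⊖ x) => //; rewrite (gadd_morphN _ diagD).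
Qed.

Definition diag_subgyrogroup :=
  Subgyrogroup diag_carrier_neq0 diag_carrier_add diag_carrier_opp.

Lemma diag_embedding : topologically_isomorphic G (subgyro diag_subgyrogroup).
Proof.
pose F x : subgyro diag_subgyrogroup :=
  @mk_subgyro _ diag_subgyrogroup (diag x) (ex_intro2 _ _ x Logic.I erefl).
(* A choice of preimages in the range; [diag_inj] makes it a two-sided inverse. *)
have [g gP] : {g : subgyro diag_subgyrogroup -> G & forall z, F (g z) = z}.
  apply: (@choice _ _ (fun z x => F x = z)) => z.
  have [x _ xz] := subgyro_valP z.
  by exists x; apply: subgyro_val_inj.
exists F, g; split.
- by move=> x y; apply: subgyro_val_inj; exact: diagD.
- by move=> x; apply: diag_inj; exact: (congr1 (@subgyro_val _ _) (gP (F x))).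
- exact: gP.
- move=> x A /nbhs_initialP[U Ux UA].
  suff : nbhs x (diag @^-1` U).
    by apply: (@filterS _ (nbhs x)) => y Uy; exact: (UA (F y)).
  suff : diag @ x --> diag x by apply.
  by apply/prod_topology_cvgP => i V; exact: fc.
- move=> z A /f_nbhs[i [V Vx VA]]; apply/nbhs_initialP.
  exists [set t | V (t i)].
    apply: prod_topology_proj; move: Vx.
    by rewrite -[in X in _ -> X](gP z).
  by move=> y Vy; apply: VA; move: Vy; rewrite -{1}(gP y).
Qed.

End Embedding.

(** * Subspaces of products are omega-balanced *)

Section OmegaBalancedSets.
Variable G : topologizedGyrogroupType.

Definition omega_sets : set_system G := [set U | exists gamma : set (set G),
  [/\ countable gamma, gamma `<=` open_nbhs gzero & subordinated gamma U]].

(** For an intersection, take pairwise intersections of the two families; injectivity of [conj2]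
    identifies the two preimages in the second condition. For the whole space, surjectivity of
    [conj2] is used. *)
Lemma omega_sets_filter : Filter omega_sets.
Proof.
split.
- exists [set setT]; split; first exact: countable1.
    by move=> _ ->; split; first exact: openT.
  split=> x y; exists setT => // w _.
  by exists (conj2_inv x y w) => //; exact: conj2_invK.
- move=> U U' [gam [cg go [g1 g2]]] [gam' [cg' go' [g1' g2']]].
  exists [set V.1 `&` V.2 | V in gam `*` gam']; split.
  + by apply: (sub_countable (card_image_le _ _)); exact: countableX.
  + by move=> _ [[V V'] /= [/go ? /go' ?] <-]; exact: open_nbhsI.
  + split=> x y.
      have [V gV VU] := g1 x y; have [V' gV' VU'] := g1' x y.
      exists (V `&` V'); first by exists (V, V').
      by move=> _ [v [Vv Vv'] <-]; split; [apply: VU|apply: VU']; exists v.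
    have [V gV VU] := g2 x y; have [V' gV' VU'] := g2' x y.
    exists (V `&` V'); first by exists (V, V').
    move=> _ [/VU[u Uu <-] /VU'[u' Uu' /(can_inj (@conj2K _ x y)) e]].
    by exists u => //; rewrite -e in Uu *.
- move=> U U' UU' [gam [cg go [g1 g2]]]; exists gam; split=> //; split=> x y.
    have [V gV VU] := g1 x y; exists V => //; exact: subset_trans VU UU'.
  have [V gV VU] := g2 x y; exists V => // v /VU[u /UU' Uu <-].
  by exists u.
Qed.

End OmegaBalancedSets.

Lemma continuous_conj2 (G : topologizedGyrogroupType) (x y : G) :
  paratopological G -> continuous (conj2 x y).
Proof.
move=> cont w.
apply: (@continuous_comp _ _ _ (fun w => (w ⊕ x) ⊕ y) (gadd (⊖ (x ⊕ y)))).
  apply: (@continuous_comp _ _ _ (fun w => w ⊕ x) (fun w => w ⊕ y));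
    exact: (continuous_radd cont).
exact: (continuous_ladd cont).
Qed.

Lemma continuous_rsub (G : topologizedGyrogroupType) (x : G) :
  paratopological G -> continuous (rsub x).
Proof.
move=> cont w.
apply: (@continuous_comp _ _ _ (fun w => (x ⊕ w) ⊕ ⊖ x) (gadd (⊖ x))).
  apply: (@continuous_comp _ _ _ (gadd x) (fun w => w ⊕ ⊖ x)).
    exact: (continuous_ladd cont).
  exact: (continuous_radd cont).
exact: (continuous_ladd cont).
Qed.

Lemma continuous_conj2_inv (G : topologizedGyrogroupType) (x y : G) :
  paratopological G -> continuous (conj2_inv x y).
Proof.
move=> cont w.
apply: (@continuous_comp _ _ _ (fun w => rsub y ((x ⊕ y) ⊕ w)) (rsub x));
  last exact: continuous_rsub.
apply: (@continuous_comp _ _ _ (gadd (x ⊕ y)) (rsub y)).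
  exact: (continuous_ladd cont).
exact: continuous_rsub.
Qed.

(** [conj2] and its inverse are continuous and fix 0, so the preimages of U under both contain basic
    neighborhoods. *)
Lemma first_countable_omega_sets (G : topologizedGyrogroupType) :
  paratopological G -> first_countable G -> nbhs gzero `<=` @omega_sets G.
Proof.
move=> cont /(_ gzero)[B [cB Bn Bb]] U U0.
(* Interiors are taken because a subordinated family must consist of open sets. *)
have base N : nbhs gzero N -> exists2 V, (interior @` B) V & V `<=` N.
  move=> /Bb[V BV VN]; exists (interior V); first by exists V.
  exact: subset_trans (@interior_subset _ _) VN.
exists (interior @` B); split.
- exact: (sub_countable (card_image_le _ _)).
- by move=> _ [V /Bn V0 <-]; split; [exact: open_interior|].
- split=> x y.
    have := @continuous_conj2 _ x y cont gzero; rewrite /continuous_at conj2_0.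
    move=> /(_ _ U0)/base[V BV VU]; exists V => //.
    by move=> _ [v Vv <-]; exact: VU.
  have := @continuous_conj2_inv _ x y cont gzero.
  rewrite /continuous_at conj2_inv0.
  move=> /(_ _ U0)/base[V BV VU]; exists V => // v Vv.
  by exists (conj2_inv x y v); [exact: VU|exact: conj2_invK].
Qed.

Lemma omega_sets_preimage (G H : topologizedGyrogroupType) (f : G -> H) U :
  (forall x y, f (x ⊕ y) = f x ⊕ f y) -> continuous f ->
  @omega_sets H U -> @omega_sets G (f @^-1` U).
Proof.
move=> fD fc [gam [cg go [g1 g2]]].
have f_conj2 x y w : f (conj2 x y w) = conj2 (f x) (f y) (f w).
  by rewrite /conj2 !fD (gadd_morphN _ fD) !fD.
exists (preimage f @` gam); split.
- exact: (sub_countable (card_image_le _ _)).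
- move=> _ [V /go[oV V0] <-]; split.
    2: by rewrite /preimage/= (gadd_morph0 fD).
  by apply: open_comp => // x _; exact: fc.
- split=> x y.
    have [V gV VU] := g1 (f x) (f y).
    exists (f @^-1` V); first by exists V.
    by move=> _ [v Vv <-]; apply: VU; exists (f v) => //; exact/esym/f_conj2.
  have [V gV VU] := g2 (f x) (f y).
  exists (f @^-1` V); first by exists V.
  (* The homomorphism sends this preimage of v to u, as [conj2] is injective in the target. *)
  move=> v /VU[u Uu uE]; exists (conj2_inv x y v); last exact: conj2_invK.
  suff -> : (f @^-1` U) (conj2_inv x y v) = U u by [].
  rewrite /preimage/=; congr U; apply: (can_inj (@conj2K _ (f x) (f y))).
  by rewrite -f_conj2 conj2_invK.
Qed.

Lemma omega_balanced_of_embedding (G : topologizedGyrogroupType) (I : Type)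
    (H : I -> topologizedGyrogroupType)
    (S : subgyrogroup (prod_topology (fun i => H i : Type))) :
  (forall i, [/\ first_countable (H i), kolmogorov_space (H i) &
     paratopological (H i)]) ->
  topologically_isomorphic G (subgyro S) ->
  kolmogorov_space G /\ omega_balanced G.
Proof.
move=> Hi [f [g [fD fK gK fc gc]]].
pose h i (x : G) : H i := subgyro_val (f x) i.
have hD i x y : h i (x ⊕ y) = h i x ⊕ h i y by rewrite /h fD.
have hc i : continuous (h i).
  move=> x A hA.
  suff : nbhs (f x) [set z : subgyro S | A (subgyro_val z i)] by exact: (fc x).
  apply/nbhs_initialP.
  exists [set t | A (t i)] => //.
  exact: (@prod_topology_proj _ (fun i => H i : topologicalType)).
split.
  move=> x y /eqP xy; have [i] : exists i, h i x <> h i y.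
    apply: contrapT => /forallNP hxy; apply: xy; apply: (can_inj fK).
    apply: subgyro_val_inj; apply: functional_extensionality_dep => i.
    exact: contrapT (hxy i).
  have [_ T0 _] := Hi i.
  move=> /eqP/T0[A AE]; exists (h i @^-1` A).
  by case: AE => -[]; rewrite !inE => /hc hA nA; [left|right].
move=> U U0; suff : @omega_sets G U by [].
have FF := omega_sets_filter G.
have Sg : nbhs (f gzero) (g @^-1` U) by apply: gc; rewrite fK.
have /nbhs_initialP[W W0 WU] := Sg.
(* U contains the preimage of a product neighborhood W of the image of 0, so convergence of the
   filter puts U in it. *)
have cvg : (fun x => subgyro_val (f x)) @ @omega_sets G -->
    subgyro_val (f gzero).
  apply/prod_topology_cvgP => i A; have [fcH _ cont] := Hi i.
  rewrite -[subgyro_val (f gzero) i]/(h i gzero) (gadd_morph0 (hD i)).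
  move=> /(first_countable_omega_sets cont fcH).
  by move=> /(omega_sets_preimage (hD i) (@hc i)).
apply: (@filterS _ (@omega_sets G) FF _ _ _ (cvg _ W0)) => x Wx.
by rewrite -(fK x); exact: (WU (f x)).
Qed.

Theorem theorem3p22 (G : topologizedGyrogroupType)
    (Gstrong : strongly_paratopological G) (Gcomm : gyrocommutative G) :
  (exists (I : Type) (H : I -> topologizedGyrogroupType),
     (forall i, [/\ first_countable (H i), kolmogorov_space (H i),
        strongly_paratopological (H i) & gyrocommutative (H i)]) /\
     exists S : subgyrogroup (prod_topology (fun i => H i : Type)),
       topologically_isomorphic G (subgyro S))
  <-> kolmogorov_space G /\ omega_balanced G.
Proof.
split.
  move=> [I [H [Hi [S GS]]]]; apply: omega_balanced_of_embedding GS => i.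
  by have [? ? []] := Hi i.
move=> [GT0 Gbal]; have [Gpara _] := Gstrong.
(* One factor for each countable gyration-invariant base of neighborhoods of 0. *)
pose I := {B : set (set G) | [/\ gyro_base B, countable B & B `<=` nbhs gzero]}.
pose hB (i : I) : gyro_base (sval i) := let: And3 h _ _ := svalP i in h.
pose H (i : I) := base_quotient Gcomm (hB i).
have Hi (i : I) : [/\ first_countable (H i), kolmogorov_space (H i),
    strongly_paratopological (H i) & gyrocommutative (H i)].
  by apply: base_quotient_spec; have [] := svalP i.
pose f (i : I) : G -> H i := quot_proj (hB i).
have fD i x y : f i (x ⊕ y) = f i x ⊕ f i y by exact: quot_projD.
have fc i : continuous (f i).
  by apply: quot_proj_continuous => //; have [] := svalP i.
exists I, H; split=> //; eexists.
apply: (diag_embedding Gpara fD fc) => // [U U0|i].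
  2: by have [_ _ []] := Hi i.
have [B [hB' cB Bn [V BV VU]]] := gyro_base_exists Gstrong Gbal U0.
pose i : I := exist _ B (And3 hB' cB Bn).
(* The image of W is the neighborhood required in the factor of B: its preimage, the saturation of
   W, stays inside V. *)
have [W BW WV] := quot_base_sat (hB i) BV.
exists i, (quot_proj (hB i) @` W); last exact: subset_trans WV VU.
by apply: (@base_nbhs0 (H i) (@quot_base _ _ (hB i))) => //; exists W.
Qed.
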